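(* Let $l\ge2$ be an integer, let $\mathfrak N=\{n_k\}_{k\ge1}$ be a $3$-lacunary sequence of positive integers, and let $p>2$. Then for every finite sum $$S(x)=\sum_{m\in\mathfrak N(l)}c_me^{2\pi imx}$$ (complex coefficients $c_m$, only finitely many nonzero) one has $$\|S\|_p\le (8(p-1))^{l/2}\,\|S\|_2 .$$
   Context: Norms are those of $L^p(0,1)$ with Lebesgue measure. A sequence of positive integers $\{n_k\}_{k\ge 1}$ is $3$-lacunary if $n_{k+1}/n_k>3$ for all $k\ge1$. For $\mathfrak N=\{n_k\}_{k\ge1}$, $\mathfrak N(l)$ is the set of all integers $m\in\mathbb Z$ that can be written as $m=\varepsilon_1 n_{k_1}+\dots+\varepsilon_l n_{k_l}$ with $\varepsilon_j\in\{1,-1\}$ and indices $k_1>k_2>\dots>k_l\ge 1$. *)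

(* Defs.v *)
From HB Require Import structures.
From mathcomp Require Import all_boot all_order all_algebra.
From mathcomp Require Import all_classical all_reals all_analysis.
From mathcomp Require Import complex.

Set Implicit Arguments.
Unset Strict Implicit.
Unset Printing Implicit Defensive.

Import Order.TTheory GRing.Theory Num.Theory.
Import numFieldNormedType.Exports.

Local Open Scope classical_set_scope.
Local Open Scope ring_scope.

(* Sequences are indexed from 0: n k is the term written n_(k+1) when the
   indices start at 1. *)
Definition lacunary3 (n : nat -> nat) : Prop :=
  forall k, (3 < (n k.+1)%:R / (n k)%:R :> rat).

Definition signed_sums (n : nat -> nat) (l : nat) : set int :=
  [set m | exists (k : 'I_l -> nat) (eps : 'I_l -> int),
    [/\ forall i j : 'I_l, (i < j)%N -> (k j < k i)%N,
        forall j, eps j = 1 \/ eps j = -1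
      & m = \sum_(j < l) eps j * (n (k j))%:Z]].

Definition expi (R : realType) (t : R) : R[i] := Complex (cos t) (sin t).

(* The sum ranges over a set that may be infinite; it is the finite sum of its
   nonzero terms, provided c has finite support in A (and 0 otherwise). *)
Definition trig_sum (R : realType) (A : set int) (c : int -> R[i]) (x : R) :
    R[i] :=
  \sum_(m \in A) c m * expi (2 * pi * m%:~R * x).

Definition cLnorm01 (R : realType) (p : R) (f : R -> R[i]) : \bar R :=
  ('N[mrestr lebesgue_measure (measurable_itv `]0%R, 1%R[)]_(p%:E)
    [EFin \o (@Normc.normc R \o f)])%E.

(* Main.v *)
(** Write S as a sum over words of digits -1, 0, 1, a word s standing for the
    integer lam s = sum_k s_k n_k; 3-lacunarity makes lam injective, so that
    S = sum of d_s e(lam s x) over the words with exactly l nonzero digits.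
    For signs r_k let S_r have the coefficients of S multiplied by the product
    of the r_k with s_k <> 0.  The Riesz product prod_k (1 + r_k cos(2 pi n_k y))
    is a positive weight of mean 1 whose convolution with S_r is 2^-l S, hence
    |S|_p <= 2^l |S_r|_p for every r.  For fixed x, S_r(x) is a homogeneous
    chaos of degree l in the signs, so averaging over r, hypercontractivity on
    the cube contributes (p-1)^(l/2), and merging the 2^l words with the same
    support contributes 2^(l/2); the product is (8(p-1))^(l/2).
    All averages over the circle are taken over a grid of M-th roots of unity
    with M larger than any difference of frequencies, so that the estimate holds
    for the average of |S|^p over every translate of the grid; only at the end
    are such averages integrated in the translate. *)

Require Import Defs.
From HB Require Import structures.
From mathcomp Require Import all_boot all_order all_algebra.
From mathcomp Require Import all_classical all_reals all_analysis.
From mathcomp Require Import complex zify ring lra measurable_realfun.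

Import Order.TTheory GRing.Theory Num.Theory.
Import numFieldNormedType.Exports.

Local Open Scope classical_set_scope.
Local Open Scope ring_scope.

Set Implicit Arguments.
Unset Strict Implicit.
Unset Printing Implicit Defensive.

(** * The two-point inequality for real numbers *)

Lemma ge0_is_derive_le (R : realType) (f df : R -> R) (a b : R) : a <= b ->
  (forall x, x \in `[a, b] -> is_derive x 1 f (df x)) ->
  (forall x, x \in `[a, b] -> 0 <= df x) -> f a <= f b.
Proof.
move=> ab fdf df0; have oc : {subset `]a, b[ <= `[a, b]}.
  by move=> x; rewrite !in_itv => /andP[? ?] /=; rewrite !ltW.
have cf : {within `[a, b], continuous f}.
  apply: derivable_within_continuous => x xab.
  by have [] := fdf _ xab.
have [c cab fE] := MVT_segment ab (fun x xab => fdf x (oc x xab)) cf.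
by rewrite -subr_ge0 fE mulr_ge0 ?df0 ?subr_ge0.
Qed.

Lemma is_derive_powR1D (R : realType) (q x : R) : 0 < 1 + x ->
  is_derive x 1 (fun t => (1 + t) `^ q) (q * (1 + x) `^ (q - 1)).
Proof.
move=> x0; pose g (t : R) := 1 + t.
have dg : is_derive x 1 g 1.
  by have := is_deriveD (is_derive_cst (1 : R) x 1) (is_derive_id x 1); rewrite add0r.
have dp : is_derive (g x) 1 ((@powR R)^~ q) (q * (g x) `^ (q - 1)).
  exact: is_derive1_powR.
have := @is_derive1_comp _ _ g _ _ _ dp dg.
by rewrite mulr1.
Qed.

Lemma is_derive_powR1B (R : realType) (q x : R) : x < 1 ->
  is_derive x 1 (fun t => (1 - t) `^ q) (- (q * (1 - x) `^ (q - 1))).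
Proof.
move=> x1; pose g (t : R) := 1 - t.
have dg : is_derive x 1 g (-1).
  by have := is_deriveB (is_derive_cst (1 : R) x 1) (is_derive_id x 1); rewrite sub0r.
have dp : is_derive (g x) 1 ((@powR R)^~ q) (q * (g x) `^ (q - 1)).
  by apply: is_derive1_powR; rewrite subr_gt0.
have := @is_derive1_comp _ _ g _ _ _ dp dg.
by rewrite mulrN1.
Qed.

(** The right side minus the left is [f]; it vanishes at 0, and its derivative [df] is nonnegative
    because (1 + x)^(q - 1) dominates (1 - x)^(q - 1). *)
Lemma powR_symm_diff_le (R : realType) (q t : R) : 1 <= q -> 0 <= t < 1 ->
  (1 + t) `^ q - (1 - t) `^ q <= q * t * ((1 + t) `^ q + (1 - t) `^ q).
Proof.
move=> q1 /andP[t0 t1].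
pose f x := q * x * ((1 + x) `^ q + (1 - x) `^ q)
            - ((1 + x) `^ q - (1 - x) `^ q).
pose df x := q * x * (1 + q) * ((1 + x) `^ (q - 1) - (1 - x) `^ (q - 1)).
suff : f 0 <= f t.
  have -> : f 0 = 0 by rewrite /f mulr0 mul0r addr0 subr0 !subrr.
  by rewrite subr_ge0.
apply: (@ge0_is_derive_le _ f df) => [//|x|x]; rewrite in_itv/= => /andP[x0 xt].
  have x1 : x < 1 by apply: le_lt_trans t1.
  have px : 0 < 1 + x by lra.
  have d1 := @is_derive_powR1D _ q _ px.
  have d2 := @is_derive_powR1B _ q _ x1.
  apply: is_derive_eq.
  rewrite /df /= /GRing.scale /= -(@mulr_powRB1 _ (1 + x) q) ?ltW //; last by lra.
  rewrite -(@mulr_powRB1 _ (1 - x) q) ?subr_ge0 ?ltW //; last by lra.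
  ring.
rewrite mulr_ge0 ?mulr_ge0//; [lra..|].
by rewrite subr_ge0 ge0_ler_powR// ?nnegrE; lra.
Qed.

(* Logarithmic derivatives in t: their comparison reduces to
   [powR_symm_diff_le]. *)
Lemma two_point_lt1 (R : realType) (p t : R) : 2 <= p -> 0 <= t < 1 ->
  ((1 + t) `^ p + (1 - t) `^ p) / 2 <= (1 + (p - 1) * t ^+ 2) `^ (p / 2).
Proof.
move=> p2 /andP[t0 t1].
pose A x := (1 + x) `^ p + (1 - x) `^ p.
pose B x := 1 + (p - 1) * x ^+ 2.
have A0 x : 0 <= x -> 0 < A x.
  by move=> x0; rewrite ltr_wpDr ?powR_ge0// powR_gt0; lra.
have B0 x : 0 < B x.
  by rewrite ltr_pwDl// mulr_ge0 ?sqr_ge0//; lra.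
pose f x := p / 2 * ln (B x) - ln (A x).
pose X x := (1 + x) `^ (p - 1).
pose Y x := (1 - x) `^ (p - 1).
pose df x := p / (A x * B x) * ((p - 1) * x * (X x + Y x) - (X x - Y x)).
have : f 0 <= f t.
  apply: (@ge0_is_derive_le _ f df) => [//|x|x]; rewrite in_itv/= => /andP[x0 xt].
    have x1 : x < 1 by apply: le_lt_trans t1.
    have px : 0 < 1 + x by lra.
    have d1 := @is_derive_powR1D _ p _ px.
    have d2 := @is_derive_powR1B _ p _ x1.
    have dA : is_derive x 1 A (p * X x - p * Y x) by exact: is_deriveD.
    have dB : is_derive x 1 B (2 * (p - 1) * x).
      by apply: is_derive_eq; rewrite /GRing.scale /=; ring.
    have lA := is_derive1_ln (A0 _ x0).
    have lB := is_derive1_ln (B0 x).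
    have dlA := @is_derive1_comp _ (@ln R) A _ _ _ lA dA.
    have dlB := @is_derive1_comp _ (@ln R) B _ _ _ lB dB.
    have df' : is_derive x 1 (p / 2 \*: (@ln R \o B) - (@ln R \o A))
      (p / 2 *: ((B x)^-1 * (2 * (p - 1) * x)) - (A x)^-1 * (p * X x - p * Y x)).
      exact: is_deriveB.
    apply: (is_derive_eq df'); rewrite /df /GRing.scale /=.
    have AE : A x = (1 + x) * X x + (1 - x) * Y x.
      by rewrite /A /X /Y !mulr_powRB1//; lra.
    have := A0 _ x0; have := B0 x; rewrite AE /B => B1 A1.
    by field; rewrite !gt_eqF.
  have AB0 : 0 <= A x * B x by rewrite ltW// mulr_gt0 ?A0.
  rewrite mulr_ge0 ?divr_ge0//; first by lra.
  by rewrite subr_ge0 /X /Y powR_symm_diff_le//; lra.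
(* Here f 0 = - ln 2, which accounts for the division by 2 in the claim. *)
rewrite /f {1}/B {1}/A expr0n !mulr0 !addr0 subr0 powR1 ln1 mulr0 sub0r.
move=> h; have : ln (A t / 2) <= ln (B t `^ (p / 2)).
  by rewrite ln_powR ln_div ?posrE ?A0 //; move: h; rewrite -[1+1]/2; lra.
by rewrite ler_ln// posrE ?divr_gt0 ?A0 ?powR_gt0.
Qed.

(** The derivative of (1 - t)^p is available only for t < 1, so the endpoint is reached as a limit:
    after taking p-th roots, the case t < 1 is applied at [s], within e of 1. *)
Lemma two_point_le1 (R : realType) (p t : R) : 2 <= p -> 0 <= t <= 1 ->
  ((1 + t) `^ p + (1 - t) `^ p) / 2 <= (1 + (p - 1) * t ^+ 2) `^ (p / 2).
Proof.
move=> p2 /andP[t0]; rewrite le_eqVlt => /predU1P[->|t1]; last first.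
  by apply: two_point_lt1; rewrite ?t0.
have p0 : 0 < p by lra.
rewrite subrr powR0 ?gt_eqF// addr0 expr1n mulr1 subrKC.
pose K : R := 2 * p `^ (p / 2).
have K0 : 0 <= K by rewrite mulr_ge0 ?powR_ge0.
suff : 1 + 1 <= K `^ p^-1.
  move=> h; have : (1 + 1) `^ p <= (K `^ p^-1) `^ p.
    by rewrite ge0_ler_powR// ?nnegrE ?powR_ge0; lra.
  by rewrite -powRrM mulVf ?gt_eqF// powRr1// /K; lra.
apply/ler_addgt0Pr => e e0.
pose s := Num.max 0 (1 - e).
have s01 : 0 <= s < 1 by rewrite /s le_max lexx/= gt_max; lra.
have se : 1 - e <= s by rewrite /s le_max lexx orbT.
suff : 1 + s <= K `^ p^-1 by lra.
have := two_point_lt1 p2 s01 => h.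
have h1 : (1 + s) `^ p <= K.
  have : (1 + (p - 1) * s ^+ 2) `^ (p / 2) <= p `^ (p / 2).
    have s2 : (p - 1) * s ^+ 2 <= p - 1.
      by rewrite ler_piMr ?exprn_ile1//; lra.
    have s20 : 0 <= (p - 1) * s ^+ 2 by rewrite mulr_ge0 ?sqr_ge0//; lra.
    by rewrite ge0_ler_powR// ?nnegrE; lra.
  have := powR_ge0 (1 - s) p.
  by rewrite /K; lra.
have : ((1 + s) `^ p) `^ p^-1 <= K `^ p^-1.
  by rewrite ge0_ler_powR// ?nnegrE ?powR_ge0// invr_ge0 ltW.
by rewrite -powRrM mulfV ?gt_eqF// powRr1//; lra.
Qed.

(** By homogeneity the larger of a and b can be scaled to 1. *)
Lemma two_point (R : realType) (p a b : R) : 2 <= p -> 0 <= a -> 0 <= b ->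
  ((a + b) `^ p + `|a - b| `^ p) / 2 <= (a ^+ 2 + (p - 1) * b ^+ 2) `^ (p / 2).
Proof.
move=> p2; have p0 : p != 0 by rewrite gt_eqF//; lra.
have main (x y : R) : 0 <= y <= x ->
    ((x + y) `^ p + (x - y) `^ p) / 2 <= (x ^+ 2 + (p - 1) * y ^+ 2) `^ (p / 2).
  move=> /andP[y0 yx]; have [x0|x0] := leP x 0.
    have -> : x = 0 by lra.
    have -> : y = 0 by lra.
    by rewrite addr0 subr0 powR0// addr0 mul0r powR_ge0.
  have xE : x `^ p = (x ^+ 2) `^ (p / 2).
    by rewrite -powR_mulrn ?ltW// -powRrM mulrCA mulfV// mulr1.
  have t01 : 0 <= y / x <= 1.
    by rewrite divr_ge0 ?ler_pdivrMr ?mul1r//= ltW.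
  have -> : x + y = x * (1 + y / x) by field; rewrite gt_eqF.
  have -> : x - y = x * (1 - y / x) by field; rewrite gt_eqF.
  have -> : x ^+ 2 + (p - 1) * y ^+ 2 = x ^+ 2 * (1 + (p - 1) * (y / x) ^+ 2).
    by field; rewrite gt_eqF.
  case/andP: (t01) => ? ?.
  have h1 : 0 <= 1 + y / x by lra.
  have h2 : 0 <= 1 - y / x by lra.
  have h3 : 0 <= 1 + (p - 1) * (y / x) ^+ 2.
    by rewrite addr_ge0// mulr_ge0 ?sqr_ge0//; lra.
  have x0' := ltW x0.
  rewrite (powRM _ (sqr_ge0 x) h3) (powRM _ x0' h1) (powRM _ x0' h2).
  rewrite -xE -mulrDr -mulrA ler_pM2l ?powR_gt0//.
  exact: two_point_le1.
move=> a0 b0; have [ba|ab] := leP b a.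
  by rewrite ger0_norm ?subr_ge0// main// b0.
rewrite distrC ger0_norm ?subr_ge0 ?(ltW ab)// [a + b]addrC.
have ab' : 0 <= a <= b by rewrite a0 ltW.
(* When a < b, exchanging a and b fixes the left side, and moving the factor p - 1 >= 1 onto the
   larger square only increases the right side. *)
apply: (le_trans (main b a ab')).
have ab2 : a ^+ 2 <= b ^+ 2 by rewrite ler_sqr ?nnegrE// ltW.
have a20 := sqr_ge0 a.
by rewrite ge0_ler_powR// ?nnegrE; nra.
Qed.

(** * Convexity and the two-point inequality for vectors *)

Lemma ler_powR_conv (R : realType) (q t x y : R) : 1 <= q -> 0 <= t <= 1 ->
  0 <= x -> 0 <= y ->
  (t * x + (1 - t) * y) `^ q <= t * x `^ q + (1 - t) * y `^ q.
Proof.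
move=> q1 /andP[t0 t1] x0 y0.
have := @convex_powR _ _ q1 (Itv01 t0 t1) x y.
by rewrite !inE/= !in_itv/= !andbT; apply.
Qed.

(* Both points z + x and z - x are averages of z + y and z - y. *)
Lemma ler_powR_spread (R : realType) (q x y z : R) : 1 <= q -> `|x| <= y ->
  y <= z -> (z + x) `^ q + (z - x) `^ q <= (z + y) `^ q + (z - y) `^ q.
Proof.
move=> q1; rewrite ler_norml => /andP[yx xy] yz.
have [y0|y0] := leP y 0.
  have -> : x = 0 by lra.
  by have -> : y = 0 by lra.
pose t := (y + x) / (2 * y).
have t01 : 0 <= t <= 1.
  rewrite divr_ge0//=; [|lra|lra].
  by rewrite ler_pdivrMr; lra.
have s01 : 0 <= 1 - t <= 1 by lra.
have zy : 0 <= z + y by lra.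
have zy' : 0 <= z - y by lra.
have := ler_powR_conv q1 t01 zy zy'.
have := ler_powR_conv q1 s01 zy zy'.
have -> : t * (z + y) + (1 - t) * (z - y) = z + x.
  by rewrite /t; field; rewrite gt_eqF.
have -> : (1 - t) * (z + y) + (1 - (1 - t)) * (z - y) = z - x.
  by rewrite /t; field; rewrite gt_eqF.
lra.
Qed.

(** Lagrange's identity: twice the defect is the double sum of the squares of u_i v_j - u_j v_i. *)
Lemma Cauchy_Schwarz_sum (R : realType) (I : finType) (u v : I -> R) :
  (\sum_i u i * v i) ^+ 2 <= (\sum_i u i ^+ 2) * (\sum_i v i ^+ 2).
Proof.
have : 0 <= \sum_i \sum_j (u i * v j - u j * v i) ^+ 2.
  by apply: sumr_ge0 => i _; apply: sumr_ge0 => j _; exact: sqr_ge0.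
under eq_bigr => i _.
  under eq_bigr => j _.
    have -> : (u i * v j - u j * v i) ^+ 2 = u i ^+ 2 * v j ^+ 2
      + v i ^+ 2 * u j ^+ 2 + (u i * v i) * (-2 * (u j * v j)) by ring.
    over.
  rewrite !big_split/= -!mulr_sumr; over.
rewrite !big_split/= -!mulr_suml.
nra.
Qed.

(** The two squared norms are U + V + 2W and U + V - 2W with |W| <= |u||v|. By [ler_powR_spread] the
    extreme case is that of collinear vectors, which is [two_point] for the norms with p = 2q. *)
Lemma two_point_vector (R : realType) (I : finType) (q : R) (u v : I -> R) :
  1 <= q ->
  (\sum_i (u i + v i) ^+ 2) `^ q + (\sum_i (u i - v i) ^+ 2) `^ q <=
  2 * (\sum_i u i ^+ 2 + (2 * q - 1) * \sum_i v i ^+ 2) `^ q.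
Proof.
move=> q1; set U := \sum_i u i ^+ 2; set V := \sum_i v i ^+ 2.
pose W := \sum_i u i * v i.
have U0 : 0 <= U by apply: sumr_ge0 => i _; exact: sqr_ge0.
have V0 : 0 <= V by apply: sumr_ge0 => i _; exact: sqr_ge0.
have -> : \sum_i (u i + v i) ^+ 2 = (U + V) + 2 * W.
  rewrite mulr_sumr -!big_split/=; apply: eq_bigr => i _; ring.
have -> : \sum_i (u i - v i) ^+ 2 = (U + V) - 2 * W.
  rewrite mulr_sumr -sumrN -!big_split/=; apply: eq_bigr => i _; ring.
pose a := Num.sqrt U; pose b := Num.sqrt V.
have a0 : 0 <= a by exact: sqrtr_ge0.
have b0 : 0 <= b by exact: sqrtr_ge0.
have UE : U = a ^+ 2 by rewrite sqr_sqrtr.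
have VE : V = b ^+ 2 by rewrite sqr_sqrtr.
have Wab : `|W| <= a * b.
  rewrite -ler_sqr ?nnegrE ?mulr_ge0// exprMn -UE -VE -normrX ger0_norm ?sqr_ge0//.
  exact: Cauchy_Schwarz_sum.
have Wab2 : `|2 * W| <= 2 * (a * b) by rewrite normrM ger0_norm// ler_pM2l.
have ab2 : 2 * (a * b) <= U + V by have := sqr_ge0 (a - b); rewrite UE VE; lra.
apply: (le_trans (ler_powR_spread q1 Wab2 ab2)).
have -> : U + V + 2 * (a * b) = (a + b) ^+ 2 by rewrite UE VE; ring.
have -> : U + V - 2 * (a * b) = `|a - b| ^+ 2.
  by rewrite -normrX ger0_norm ?sqr_ge0// UE VE; ring.
rewrite -!powR_mulrn ?addr_ge0// -!powRrM UE VE.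
have q2 : 2 <= 2 * q by lra.
have := two_point q2 a0 b0.
have -> : 2 * q / 2 = q by field.
lra.
Qed.

(** * Words, sign characters and hypercontractivity on the cube *)

Fixpoint words (T : Type) (A : seq T) (N : nat) : seq (seq T) :=
  if N is N'.+1 then [seq x :: s | x <- A, s <- words A N'] else [:: [::]].

Lemma big_words (V : nmodType) (T : Type) (A : seq T) (N : nat)
    (F : seq T -> V) :
  \sum_(s <- words A N.+1) F s =
  \sum_(x <- A) \sum_(s <- words A N) F (x :: s).
Proof. exact: big_allpairs_dep. Qed.

Lemma big_words0 (V : nmodType) (T : Type) (A : seq T) (F : seq T -> V) :
  \sum_(s <- words A 0) F s = F [::].
Proof. exact: big_seq1. Qed.

Lemma mem_words (T : eqType) (A : seq T) (N : nat) (s : seq T) :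
  (s \in words A N) = (size s == N) && all [in A] s.
Proof.
elim: N s => [|N IH] [|x s] //=; first by apply/negbTE/negP => /allpairsP[[? ?] []].
apply/allpairsP/idP => [[[y t] [/= yA tN [-> ->]]]|].
  by move: tN; rewrite IH eqSS yA => /andP[-> ->].
by case/and3P => sN xA sA; exists (x, s); rewrite IH -eqSS sN sA.
Qed.

Lemma words_uniq (T : eqType) (A : seq T) (N : nat) : uniq A -> uniq (words A N).
Proof.
by move=> uA; elim: N => //= N IH; apply: allpairs_uniq => // -[? ?] [? ?] _ _ [-> ->].
Qed.

Lemma size_words (T : Type) (A : seq T) (N : nat) :
  size (words A N) = (size A ^ N)%N.
Proof. by elim: N => //= N IH; rewrite size_allpairs IH expnS. Qed.

Definition signs (R : realType) : seq R := [:: 1; -1].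
Definition digits : seq int := [:: 0; 1; -1].
Definition weight (s : seq int) : nat := count [pred e | e != 0] s.

(** The Walsh function of the support of [s], evaluated at the signs [r]; words that differ only in
    the signs of their digits share it. *)
Fixpoint chi (R : realType) (r : seq R) (s : seq int) : R :=
  match r, s with
  | x :: r', e :: s' => (if e == 0 then 1 else x) * chi r' s'
  | _, _ => 1
  end.

Lemma sum_signs (V : nmodType) (R : realType) (F : R -> V) :
  \sum_(x <- signs R) F x = F 1 + F (-1).
Proof. by rewrite !big_cons big_nil addr0. Qed.

Lemma sum_digits (V : nmodType) (F : int -> V) :
  \sum_(e <- digits) F e = F 0 + (F 1 + F (-1)).
Proof. by rewrite !big_cons big_nil addr0. Qed.

(* Since the coefficients are vectors indexed by an arbitrary finite type, the
   induction applies the two-point inequality to the first sign and then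
   regards the three coefficient families (first digit 0, 1, -1) as a single
   vector-valued one; no Minkowski inequality is needed.  The usual noise
   rate sigma^2 = 1 / (p - 1), with p = 2 q, is halved to pay for
   |g_1 + g_-1|^2 <= 2 (|g_1|^2 + |g_-1|^2). *)
Lemma hypercontractive (R : realType) (N : nat) (I : finType) (q sigma : R)
    (b : I -> seq int -> R) : 1 <= q -> sigma ^+ 2 * (2 * (2 * q - 1)) = 1 ->
  \sum_(r <- words (signs R) N)
    (\sum_i (\sum_(s <- words digits N)
       sigma ^+ weight s * chi r s * b i s) ^+ 2) `^ q <=
  2 ^+ N * (\sum_i \sum_(s <- words digits N) b i s ^+ 2) `^ q.
Proof.
move=> q1 sigmaE; have q0 : 0 <= q by lra.
elim: N I b => [|N IH] I b.
  rewrite big_words0 expr0 mul1r.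
  under eq_bigr do rewrite big_words0 expr0 /= !mul1r.
  by under [in leRHS]eq_bigr do rewrite big_words0.
pose g e i r := \sum_(s <- words digits N)
  sigma ^+ weight s * chi r s * b i (e :: s).
have gE x i r : \sum_(s <- words digits N.+1)
    sigma ^+ weight s * chi (x :: r) s * b i s
    = g 0 i r + x * (sigma * (g 1 i r + g (-1) i r)).
  rewrite big_words sum_digits /g !mulrDr !mulr_sumr.
  congr (_ + (_ + _)); apply: eq_bigr => s _ /=.
  - by rewrite mul1r.
  - rewrite exprS; ring.
  - rewrite exprS; ring.
rewrite big_words sum_signs -big_split/=.
pose b' (j : I + (I + I)) s := match j with
  | inl i => b i (0 :: s)
  | inr (inl i) => b i (1 :: s)
  | inr (inr i) => b i (-1 :: s) end.
have -> : \sum_i \sum_(s <- words digits N.+1) b i s ^+ 2 =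
          \sum_j \sum_(s <- words digits N) b' j s ^+ 2.
  under eq_bigr do rewrite big_words sum_digits.
  by rewrite !big_split !big_sumType.
rewrite exprS -mulrA; apply: le_trans (ler_wpM2l _ (IH _ b')) => //.
rewrite mulr_sumr; apply: ler_sum => r _.
under eq_bigr do rewrite gE mul1r.
under [X in _ + X `^ _]eq_bigr do rewrite gE mulN1r.
apply: le_trans (two_point_vector _ _ q1) _.
rewrite ler_pM2l// ge0_ler_powR// ?nnegrE.
- have q'0 : 0 <= 2 * q - 1 by lra.
  by rewrite addr_ge0 ?mulr_ge0 ?sumr_ge0// => i _; exact: sqr_ge0.
- by apply: sumr_ge0 => i _; exact: sqr_ge0.
rewrite !big_sumType/= -/(g _ _ _) lerD2l mulr_sumr -big_split/=.
apply: ler_sum => i _; rewrite -!/(g _ _ _) exprMn.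
have := sqr_ge0 (g 1 i r - g (-1) i r).
have -> : (2 * q - 1) * (sigma ^+ 2 * (g 1 i r + g (-1) i r) ^+ 2) =
  (sigma ^+ 2 * (2 * (2 * q - 1))) * (g 1 i r + g (-1) i r) ^+ 2 / 2 by field.
by rewrite sigmaE; nra.
Qed.

Local Open Scope complex_scope.

(** * Complex exponentials and sums over roots of unity *)

Section exponential.
Variable R : realType.
Implicit Types (t x y : R) (m : int).

Lemma expiD t u : expi (t + u : R) = expi t * expi u.
Proof. by rewrite /expi cosD sinD; simpc; rewrite addrC [X in _ +i* X]addrC. Qed.

Lemma expi0 : expi (0 : R) = 1.
Proof. by rewrite /expi cos0 sin0. Qed.

Lemma expi_nat t (k : nat) : expi (t * k%:R) = expi t ^+ k.
Proof.
elim: k => [|k IH]; first by rewrite mulr0 expi0.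
by rewrite -natr1 mulrDr mulr1 expiD IH exprSr.
Qed.

Lemma normc_expi t : Normc.normc (expi t) = 1.
Proof. by rewrite /= cos2Dsin2 sqrtr1. Qed.

Lemma expiN_mul t : expi (- t) * expi t = 1.
Proof. by rewrite -expiD addNr expi0. Qed.

Lemma expi_2pi_int m : expi (2 * pi * m%:~R : R) = 1.
Proof.
have e1 : expi (2 * pi : R) = 1 by rewrite /expi mulr_natl cos2pi sin2pi.
case: m => k; first by rewrite -pmulrn expi_nat e1 expr1n.
rewrite NegzE mulrNz mulrN; have := expiN_mul (2 * pi * k.+1%:R).
by rewrite expi_nat e1 expr1n mulr1.
Qed.

(** The half angle lies strictly between 0 and pi, so its sine is positive, whereas cos t = 1 would
    make it zero. *)
Lemma expi_neq1 t : 0 < t < 2 * pi -> expi t != 1.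
Proof.
move=> t02; apply/eqP => -[ct _].
have : 0 < sin (t / 2) by apply: sin_gt0_pi; lra.
have tE : t = (t / 2) *+ 2 by rewrite -mulr_natr divfK.
have := cos2Dsin2 (t / 2); move: ct; rewrite {1}tE cos_mulr2n; nra.
Qed.

Definition wave m x : R[i] := expi (2 * pi * m%:~R * x).

Lemma waveDl m1 m2 x : wave (m1 + m2) x = wave m1 x * wave m2 x.
Proof. by rewrite /wave rmorphD/= mulrDr mulrDl expiD. Qed.

Lemma waveDr m x y : wave m (x + y) = wave m x * wave m y.
Proof. by rewrite /wave mulrDr expiD. Qed.

Lemma waveNl m x : wave (- m) x = wave m (- x).
Proof. by rewrite /wave rmorphN/= mulrN mulNr mulrN. Qed.

Lemma wave0 x : wave 0 x = 1.
Proof. by rewrite /wave mulr0 mul0r expi0. Qed.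

Lemma wave_periodic m x : wave m (x + 1) = wave m x.
Proof. by rewrite waveDr /wave mulr1 expi_2pi_int mulr1. Qed.

Lemma waveN_mul m x : wave (- m) x * wave m x = 1.
Proof. by rewrite -waveDl addNr wave0. Qed.

(** A geometric sum whose ratio [w] is an M-th root of unity, different from 1 because 0 < |m| < M.
    This orthogonality on the grid replaces that of the exponentials on the circle. *)
Lemma sum_wave_root m (M : nat) : (`|m| < M)%N ->
  \sum_(j < M) wave m (j%:R / M%:R) = if m == 0 then M%:R else 0.
Proof.
move=> mM; have M0 : (0 < M%:R :> R) by rewrite ltr0n (leq_ltn_trans _ mM).
case: eqP => [->|/eqP m0].
  by under eq_bigr do rewrite wave0; rewrite sumr_const card_ord.
pose w := wave m M%:R^-1.
have wE (j : nat) : wave m (j%:R / M%:R) = w ^+ j.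
  by rewrite /wave mulrCA mulrC expi_nat.
have wM : w ^+ M = 1.
  by rewrite -wE /wave divff ?gt_eqF// mulr1 expi_2pi_int.
have pos (k : nat) : (0 < k)%N -> (k < M)%N -> wave k%:Z M%:R^-1 != 1.
  move=> k0 kM; apply: expi_neq1; have := @pi_gt0 R => pi0.
  have k1 : k%:R / M%:R < 1 :> R by rewrite ltr_pdivrMr// mul1r ltr_nat.
  have k2 : 0 < k%:R / M%:R :> R by rewrite divr_gt0// ltr0n.
  by rewrite -pmulrn -mulrA; nra.
have w1 : w != 1.
  (* A negative frequency reduces to a positive one, the two waves being inverse to each other. *)
  rewrite /w; case: (m) mM m0 => k; first by rewrite -lt0n => kM k0; exact: pos.
  rewrite NegzE abszN => kM _; apply: contra (pos k.+1 _ kM) => // /eqP E.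
  by have := waveN_mul k.+1%:Z M%:R^-1; rewrite E mul1r => ->.
under eq_bigr do rewrite wE.
by apply/eqP; have := subrX1 w M; rewrite wM subrr => /esym/eqP;
   rewrite mulf_eq0 subr_eq0 (negbTE w1).
Qed.

End exponential.

(** * Riesz products and lacunary frequencies *)

(* The head of a word is its digit of highest index. *)
Fixpoint lam (n : nat -> nat) (s : seq int) : int :=
  if s is e :: s' then e * (n (size s'))%:Z + lam n s' else 0.

Fixpoint riesz (R : realType) (n : nat -> nat) (r : seq R) (y : R) : R :=
  if r is x :: r' then
    (1 + x * cos (2 * pi * (n (size r'))%:R * y)) * riesz n r' y
  else 1.

Lemma riesz_ge0 (R : realType) (n : nat -> nat) (N : nat) (r : seq R) (y : R) :
  r \in words (signs R) N -> 0 <= riesz n r y.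
Proof.
elim: N r => [|N IH] r; rewrite mem_words; first by case: r => //=.
case: r => //= x r /and3P[rN xs rs]; rewrite mulr_ge0//; last first.
  by apply: IH; rewrite mem_words -eqSS rN.
have c1 := cos_le1 (2 * pi * (n (size r))%:R * y).
have c2 := cos_geN1 (2 * pi * (n (size r))%:R * y).
by move: xs; rewrite !inE => /orP[] /eqP ->; lra.
Qed.

(** Writing each cosine as half the sum of two exponentials turns a factor into three terms: digit 0
    with coefficient 1, digits 1 and -1 with coefficient x / 2. Each word picks one term per
    factor. *)
Lemma riesz_expand (R : realType) (n : nat -> nat) (N : nat) (r : seq R) (y : R) :
  size r = N ->
  (riesz n r y)%:C = \sum_(s <- words digits N)
     (2^-1 ^+ weight s * chi r s)%:C * wave (lam n s) y.
Proof.
elim: N r => [[]// _|N IH [|x r]// [rN]].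
  by rewrite big_words0 /= mulr1 wave0 mulr1.
have -> : (riesz n (x :: r) y)%:C
    = (1 + x * cos (2 * pi * (n (size r))%:R * y))%:C * (riesz n r y)%:C.
  by rewrite -rmorphM.
rewrite big_words sum_digits (IH _ rN).
set E := fun s => (2^-1 ^+ weight s * chi r s)%:C * wave (lam n s) y.
set m := (n (size r))%:Z.
have sz (s : seq int) : s \in words digits N -> size s = size r.
  by rewrite mem_words rN => /andP[/eqP].
have E1 e : \sum_(s <- words digits N)
    (2^-1 ^+ weight (e :: s) * chi (x :: r) (e :: s))%:C *
      wave (lam n (e :: s)) y
    = (if e == 0 then 1 else (2^-1 * x)%:C) * wave (e * m) y *
      \sum_(s <- words digits N) E s.
  rewrite mulr_sumr; apply: eq_big_seq => s sW /=.
  rewrite /E sz// waveDl exprD -/m; case: eqVneq => _ /=.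
    by rewrite expr0 !mul1r mulrCA.
  rewrite expr1 !rmorphM/=; ring.
rewrite !E1 /= mul0r mul1r mulN1r wave0 !mul1r -mulrDl -mulrDr.
have -> : wave m y + wave (- m) y = (2 * cos (2 * pi * (n (size r))%:R * y))%:C.
  rewrite waveNl /wave mulrN /expi cosN sinN /m -pmulrn.
  by apply/eqP; rewrite eq_complex /= subrr [2 * cos _]mulr_natl mulr2n !eqxx.
rewrite -/(E _) -(rmorphM (real_complex R)) -[X in _ = X + _]mul1r -mulrDl.
congr (_ * _); rewrite -(rmorph1 (real_complex R)) -(rmorphD (real_complex R)).
by congr (_%:C); field.
Qed.

Lemma lam_bound (n : nat -> nat) (N : nat) (s : seq int) :
  s \in words digits N -> (`|lam n s| <= \sum_(k < N) n k)%N.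
Proof.
elim: N s => [|N IH] s; rewrite mem_words; first by case: s => //=; rewrite absz0.
case: s => //= e s /and3P[sN eD sD]; rewrite eqSS in sN; rewrite big_ord_recr/=.
have sW : s \in words digits N by rewrite mem_words sN.
have := IH _ sW; rewrite (eqP sN); move: (\sum_(k < N) n k)%N (lam n s) => B z.
by move: eD; rewrite !inE => /or3P[] /eqP ->; lia.
Qed.

Lemma lacunary3_nat (n : nat -> nat) : (forall k, (0 < n k)%N) -> lacunary3 n ->
  forall k, (3 * n k < n k.+1)%N.
Proof.
move=> n0 nlac k; have := nlac k.
by rewrite ltr_pdivlMr ?ltr0n// -natrM ltr_nat.
Qed.

(** If B is the sum so far and 2B < n_N, then 2(B + n_N) < 3 n_N < n_(N+1). This is where the ratio
    3 enters. *)
Lemma lacunary3_sum (n : nat -> nat) : (forall k, (0 < n k)%N) -> lacunary3 n ->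
  forall N, (2 * \sum_(k < N) n k < n N)%N.
Proof.
move=> n0 nlac; elim=> [|N IH]; first by rewrite big_ord0.
rewrite big_ord_recr/=; have := lacunary3_nat n0 nlac N.
by move: (\sum_(k < N) n k)%N IH => B; lia.
Qed.

(** Different leading digits move the value by at least n_N, while the tails differ by at most twice
    the sum of the lower terms, which is smaller than n_N. Hence the leading digits agree, and
    induction applies to the tails. *)
Lemma lam_inj (n : nat -> nat) (N : nat) : (forall k, (0 < n k)%N) ->
  lacunary3 n -> {in words digits N &, injective (lam n)}.
Proof.
move=> n0 nlac; elim: N => [|N IH] s t; rewrite !mem_words.
  by case: s; case: t.
case: s => //= e s /and3P[sN eD sD]; case: t => //= f t /and3P[tN fD tD].
rewrite !eqSS in sN tN; rewrite (eqP sN) (eqP tN).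
have sW : s \in words digits N by rewrite mem_words sN.
have tW : t \in words digits N by rewrite mem_words tN.
have := lam_bound n sW; have := lam_bound n tW.
have := lacunary3_sum n0 nlac N; move: (\sum_(k < N) n k)%N => B B2 tB sB E.
have ef : e = f.
  by move: eD fD E; rewrite !inE => /or3P[] /eqP -> /or3P[] /eqP -> //; lia.
by move: E; rewrite ef => /addrI /(IH _ _ sW tW) ->.
Qed.

(** Frequencies differ by at most twice the sum of the n_k, hence by less than M; so no two distinct
    words alias on the grid and only s = t survives. *)
Lemma sum_words_orth (R : realType) (n : nat -> nat) (N M : nat) (t : seq int)
    (F : seq int -> R[i]) :
  (forall k, (0 < n k)%N) -> lacunary3 n -> (2 * \sum_(k < N) n k < M)%N ->
  t \in words digits N ->
  \sum_(s <- words digits N)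
    F s * \sum_(j < M) wave (lam n s - lam n t) (j%:R / M%:R : R) = F t * M%:R.
Proof.
move=> n0 nlac MB tW; have LM s : s \in words digits N ->
    (`|lam n s - lam n t| < M)%N.
  move=> sW; have := lam_bound n sW; have := lam_bound n tW.
  by move: (\sum_(k < N) n k)%N MB => B; lia.
rewrite (bigD1_seq t) ?words_uniq//=.
rewrite [X in _ + X = _]big_seq_cond [X in _ + X = _]big1 ?addr0.
  by rewrite sum_wave_root ?LM// subrr eqxx.
move=> s /andP[sW st]; rewrite sum_wave_root ?LM// subr_eq0.
by rewrite (inj_in_eq (lam_inj n0 nlac) sW tW) (negbTE st) ?mulr0.
Qed.

Definition poly_sum (R : realType) (n : nat -> nat) (N : nat)
    (d : seq int -> R[i]) (x : R) : R[i] :=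
  \sum_(s <- words digits N) d s * wave (lam n s) x.

Lemma chi_sq (R : realType) (N : nat) (r : seq R) (s : seq int) :
  r \in words (signs R) N -> chi r s ^+ 2 = 1.
Proof.
elim: N r s => [|N IH] r s; rewrite mem_words; first by case: r => //=; rewrite expr1n.
case: r => //= x r /and3P[rN xs rs]; case: s => [|e s]; first by rewrite expr1n.
have rW : r \in words (signs R) N by rewrite mem_words -eqSS rN.
rewrite exprMn (IH _ _ rW) mulr1.
by case: ifP; rewrite ?expr1n//; move: xs; rewrite !inE => /orP[] /eqP -> _;
  rewrite ?sqrrN expr1n.
Qed.

(** Convolution multiplies the coefficient at the word t by the Riesz coefficient 2^-l [chi r t];
    the character cancels the one already in the signed sum, since its square is 1. *)
Lemma riesz_convolution (R : realType) (n : nat -> nat) (N M l : nat)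
    (d : seq int -> R[i]) (r : seq R) (x : R) :
  (forall k, (0 < n k)%N) -> lacunary3 n -> (2 * \sum_(k < N) n k < M)%N ->
  (forall s, weight s != l -> d s = 0) -> r \in words (signs R) N ->
  \sum_(j < M) (riesz n r (j%:R / M%:R))%:C *
     poly_sum n N (fun s => (chi r s)%:C * d s) (x - j%:R / M%:R) =
  M%:R * (2^-1 ^+ l)%:C * poly_sum n N d x.
Proof.
move=> n0 nlac MB dl rW.
have rN : size r = N by move: rW; rewrite mem_words => /andP[/eqP].
pose F s := (2^-1 ^+ weight s * chi r s)%:C : R[i].
transitivity (\sum_(t <- words digits N) \sum_(s <- words digits N)
   \sum_(j < M) F s * wave (lam n s - lam n t) (j%:R / M%:R)
     * ((chi r t)%:C * d t * wave (lam n t) x)).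
  under [RHS]eq_bigr do rewrite exchange_big/=.
  rewrite [RHS]exchange_big/=; apply: eq_bigr => j _; rewrite [RHS]exchange_big/=.
  rewrite (riesz_expand _ _ rN) mulr_suml; apply: eq_bigr => s _.
  rewrite mulr_sumr; apply: eq_bigr => t _.
  rewrite waveDr waveDl waveNl -/(F s); ring.
rewrite mulr_sumr; apply: eq_big_seq => t tW.
under eq_bigr do rewrite -mulr_suml -mulr_sumr.
rewrite -mulr_suml sum_words_orth// /F.
have [wt|wt] := eqVneq (weight t) l; last by rewrite (dl _ wt) !(mulr0, mul0r).
have : ((chi r t)%:C ^+ 2 = 1 :> R[i]).
  by rewrite -(rmorphXn (real_complex R)) (chi_sq _ rW).
rewrite wt (rmorphM (real_complex R)); set c := (real_complex _ (chi r t)).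
set h := real_complex _ _ => c2.
transitivity (M%:R * h * (d t * wave (lam n t) x) * c ^+ 2); first by ring.
by rewrite c2 mulr1.
Qed.

(** * Jensen's inequality and grid sums of periodic functions *)

(** Young's inequality for the product of x and 1, with exponents p and p / (p - 1). *)
Lemma powR_Bernoulli (R : realType) (p x : R) : 1 <= p -> 0 <= x ->
  1 + p * (x - 1) <= x `^ p.
Proof.
rewrite le_eqVlt => /predU1P[<- x0|p1 x0]; first by rewrite powRr1//; lra.
have p0 : 0 < p by lra.
pose q := p / (p - 1).
have q0 : 0 < q by rewrite divr_gt0//; lra.
have pq : p^-1 + q^-1 = 1 by rewrite /q; field; rewrite !gt_eqF//; lra.
have := conjugate_powR x0 ler01 p0 q0 pq.
have -> : q^-1 = 1 - p^-1 by lra.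
rewrite powR1 !mul1r mulr1 -(ler_pM2l p0) mulrDr mulrBr [p * (_ / p)]mulrCA.
by rewrite mulfV ?gt_eqF// !mulr1; lra.
Qed.

(** The power function lies above its tangent line at the mean [m], by [powR_Bernoulli] at s_i / m;
    averaging the tangent line gives m^p. A zero mean is treated apart. *)
Lemma Jensen_powR (R : realType) (I : finType) (p : R) (w s : I -> R) :
  1 <= p -> (forall i, 0 <= w i) -> \sum_i w i = 1 -> (forall i, 0 <= s i) ->
  (\sum_i w i * s i) `^ p <= \sum_i w i * s i `^ p.
Proof.
move=> p1 w0 w1 s0; set m := \sum_i w i * s i.
have m0 : 0 <= m by apply: sumr_ge0 => i _; rewrite mulr_ge0.
have [mz|mp] := leP m 0.
  have -> : m = 0 by apply/eqP; rewrite eq_le mz.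
  rewrite powR0; last by rewrite gt_eqF//; lra.
  by apply: sumr_ge0 => i _; rewrite mulr_ge0 ?powR_ge0.
have -> : m `^ p = \sum_i w i * (m `^ p * (1 + p * (s i / m - 1))).
  transitivity (\sum_i (m `^ p * (1 - p) * w i + m `^ p * p / m * (w i * s i))).
    by rewrite big_split/= -!mulr_sumr w1 -/m; field; rewrite gt_eqF.
  by apply: eq_bigr => i _; field; rewrite gt_eqF.
apply: ler_sum => i _; rewrite ler_wpM2l//.
have sm0 : 0 <= s i / m by rewrite divr_ge0.
have {2}-> : s i = m * (s i / m) by field; rewrite gt_eqF.
by rewrite powRM// ler_wpM2l ?powR_ge0// powR_Bernoulli.
Qed.

Section periodic_grid.
Variables (R : realType) (V : nmodType) (F : R -> V) (M : nat).
Hypotheses (M0 : (0 < M)%N) (F1 : forall x, F (x + 1) = F x).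

(** The step permutes the grid cyclically; the one point that leaves it is brought back by the
    period 1. *)
Lemma sum_grid_step x :
  \sum_(i < M) F (x + i%:R / M%:R - M%:R^-1) = \sum_(i < M) F (x + i%:R / M%:R).
Proof.
case: M M0 => // m _; rewrite big_ord_recl [RHS]big_ord_recr/= addrC.
have m0 : m.+1%:R != 0 :> R by rewrite pnatr_eq0.
have mE : m%:R = m.+1%:R - 1 :> R by rewrite -natr1 addrK.
congr (_ + _); last by rewrite -[LHS]F1 mE; congr F; field.
apply: eq_bigr => i _; congr F.
by rewrite /bump/= add1n -natr1 mulrDl mul1r addrA addrK.
Qed.

Lemma sum_grid_shift (j : nat) x :
  \sum_(i < M) F (x + i%:R / M%:R - j%:R / M%:R) =
  \sum_(i < M) F (x + i%:R / M%:R).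
Proof.
elim: j x => [|j IH] x; first by under eq_bigr do rewrite mul0r subr0.
transitivity (\sum_(i < M) F (x - M%:R^-1 + i%:R / M%:R - j%:R / M%:R)).
  by apply: eq_bigr => i _; congr F; rewrite -natr1 mulrDl mul1r; ring.
rewrite IH -[RHS]sum_grid_step; apply: eq_bigr => i _; congr F; ring.
Qed.

End periodic_grid.

Lemma normc_sqrE (R : realType) (z : R[i]) :
  Normc.normc z ^+ 2 = complex.Re z ^+ 2 + complex.Im z ^+ 2.
Proof. by case: z => a b /=; rewrite sqr_sqrtr// addr_ge0 ?sqr_ge0. Qed.

Lemma normc_ge0 (R : realType) (z : R[i]) : 0 <= Normc.normc z.
Proof. by case: z => a b /=; exact: sqrtr_ge0. Qed.

Lemma normc_sum (R : realType) (I : Type) (s : seq I) (f : I -> R[i]) :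
  Normc.normc (\sum_(i <- s) f i) <= \sum_(i <- s) Normc.normc (f i).
Proof.
elim: s => [|i s IH]; first by rewrite !big_nil Normc.normc0.
by rewrite !big_cons (le_trans (le_normcD _ _))// lerD2l.
Qed.

(** * Moments over an arbitrary translate of the grid *)

Section pointwise.
Variables (R : realType) (n : nat -> nat) (N M l : nat) (d : seq int -> R[i]).
Hypotheses (n0 : forall k, (0 < n k)%N) (nlac : lacunary3 n).
Hypotheses (MB : (2 * \sum_(k < N) n k < M)%N).
Hypothesis dl : forall s, weight s != l -> d s = 0.

Let M0 : (0 < M)%N. Proof. exact: leq_ltn_trans MB. Qed.

Definition signed_sum (r : seq R) := poly_sum n N (fun s => (chi r s)%:C * d s).

Lemma poly_sum_periodic (d' : seq int -> R[i]) x :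
  poly_sum n N d' (x + 1) = poly_sum n N d' x.
Proof. by apply: eq_bigr => s _; rewrite wave_periodic. Qed.

(** Orthogonality against the zero word [z] isolates the constant term of the expansion, which is
    1. *)
Lemma riesz_mean (r : seq R) : r \in words (signs R) N ->
  \sum_(j < M) riesz n r (j%:R / M%:R) = M%:R.
Proof.
move=> rW; pose z := nseq N (0 : int).
have zW : z \in words digits N by rewrite mem_words size_nseq eqxx all_nseq orbT.
have lz k : lam n (nseq k 0) = 0 by elim: k => //= k ->; rewrite mul0r.
have wz k : weight (nseq k 0) = 0%N by elim: k => //= k ->.
have cz r' k : chi r' (nseq k 0) = 1 :> R.
  by elim: k r' => [|k IH] [|x r'] //=; rewrite IH mulr1.
have rN : size r = N by move: rW; rewrite mem_words => /andP[/eqP].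
apply: (@complexI R); rewrite rmorph_sum/=.
under eq_bigr do rewrite (riesz_expand _ _ rN).
rewrite exchange_big/=.
have := sum_words_orth
  (fun s => (2^-1 ^+ weight s * chi r s)%:C : R[i]) n0 nlac MB zW.
rewrite lz wz cz mulr1 expr0 mul1r rmorph_nat => <-.
by apply: eq_bigr => s _; rewrite mulr_sumr subr0.
Qed.

(** By [riesz_convolution] the sum is 2^l times a weighted mean of translates of the signed sum,
    with weights [w] of total mass 1. Jensen's inequality bounds the p-th power at each point. *)
Lemma riesz_domination (p : R) (r : seq R) (x : R) : 1 <= p ->
  r \in words (signs R) N ->
  \sum_(i < M) Normc.normc (poly_sum n N d (x + i%:R / M%:R)) `^ p <=
  (2 ^+ l) `^ p * \sum_(i < M) Normc.normc (signed_sum r (x + i%:R / M%:R)) `^ p.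
Proof.
move=> p1 rW; pose w (j : 'I_M) := riesz n r (j%:R / M%:R) / M%:R.
have MR : 0 < M%:R :> R by rewrite ltr0n.
have w0 j : 0 <= w j by rewrite divr_ge0 ?(riesz_ge0 _ _ rW) ?ltW.
have w1 : \sum_j w j = 1 by rewrite -mulr_suml (riesz_mean rW) divff ?gt_eqF.
have p0 : 0 <= p by lra.
have two0 : 0 <= (2 : R) ^+ l by rewrite exprn_ge0.
have dom y : Normc.normc (poly_sum n N d y) `^ p <=
    (2 ^+ l) `^ p * \sum_j w j * Normc.normc (signed_sum r (y - j%:R / M%:R)) `^ p.
  apply: le_trans (_ : (2 ^+ l * \sum_j w j *
      Normc.normc (signed_sum r (y - j%:R / M%:R))) `^ p <= _).
    have sum0 : 0 <= \sum_j w j * Normc.normc (signed_sum r (y - j%:R / M%:R)).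
      by apply: sumr_ge0 => j _; rewrite mulr_ge0 ?normc_ge0.
    rewrite ge0_ler_powR// ?nnegrE ?normc_ge0 ?mulr_ge0//.
    have := riesz_convolution y n0 nlac MB dl rW.
    move=> /(congr1 (@Normc.normc R)).
    rewrite !Normc.normcM => conv.
    have nM : Normc.normc (M%:R : R[i]) = M%:R.
      by rewrite -(rmorph_nat (real_complex R)) /= expr0n addr0 sqrtr_sqr ger0_norm ?ltW.
    have nh : Normc.normc ((2^-1 ^+ l)%:C : R[i]) = 2^-1 ^+ l.
      by rewrite /= expr0n addr0 sqrtr_sqr ger0_norm ?exprn_ge0 ?invr_ge0.
    rewrite nM nh in conv.
    have -> : Normc.normc (poly_sum n N d y) =
        2 ^+ l / M%:R * (M%:R * 2^-1 ^+ l * Normc.normc (poly_sum n N d y)).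
      have := expf_neq0 l (lt0r_neq0 (ltr0Sn R 1)); rewrite exprVn.
      by move: (2 ^+ l) => K K0; field; rewrite K0 gt_eqF.
    rewrite -conv -mulrA ler_wpM2l//.
    apply: le_trans (ler_wpM2l _ (normc_sum _ _)) _; first by rewrite invr_ge0 ltW.
    rewrite mulr_sumr; apply: ler_sum => j _; rewrite Normc.normcM.
    have -> : Normc.normc ((riesz n r (j%:R / M%:R))%:C) = riesz n r (j%:R / M%:R).
      by rewrite /= expr0n addr0 sqrtr_sqr ger0_norm ?(riesz_ge0 _ _ rW).
    by rewrite mulrA [_^-1 * _]mulrC.
  rewrite powRM ?sumr_ge0// => [|j _]; last by rewrite mulr_ge0 ?normc_ge0.
  by rewrite ler_wpM2l ?powR_ge0// Jensen_powR// => j; exact: normc_ge0.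
apply: le_trans (ler_sum _ (fun i _ => dom _)) _.
rewrite -mulr_sumr ler_wpM2l ?powR_ge0// exchange_big/=.
under eq_bigr do rewrite -mulr_sumr.
pose F x := Normc.normc (signed_sum r x) `^ p.
have F1 y : F (y + 1) = F y by rewrite /F /signed_sum poly_sum_periodic.
(* After the exchange of sums, each translate by j / M merely permutes the grid, so the weights sum
   out to 1. *)
under eq_bigr => j _ do rewrite (sum_grid_shift M0 F1).
by rewrite -mulr_suml w1 mul1r.
Qed.

(** Hypercontractivity is applied to the pair of real and imaginary parts, indexed by booleans.
    Since only words of weight l occur, dividing the coefficients by sigma^l beforehand cancels the
    noise factor and yields (2(2q - 1))^l in the squared norm. *)
Lemma signed_sum_moment (q : R) (y : R) : 1 <= q ->
  \sum_(r <- words (signs R) N) Normc.normc (signed_sum r y) `^ (2 * q) <=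
  2 ^+ N * ((2 * (2 * q - 1)) ^+ l *
            \sum_(s <- words digits N) Normc.normc (d s) ^+ 2) `^ q.
Proof.
move=> q1; pose v : R := 2 * (2 * q - 1).
have v0 : 0 < v by rewrite /v; lra.
pose sigma := (Num.sqrt v)^-1.
have s2 : sigma ^+ 2 = v^-1 by rewrite /sigma exprVn sqr_sqrtr ?ltW.
have s0 : sigma != 0 by rewrite invr_eq0 gt_eqF// sqrtr_gt0.
have sv : sigma ^+ 2 * (2 * (2 * q - 1)) = 1 by rewrite s2 mulVf ?gt_eqF.
pose part (c : bool) (z : R[i]) := if c then complex.Re z else complex.Im z.
pose b c s := part c ((sigma ^- l)%:C * d s * wave (lam n s) y).
have partE c (r : R) z : part c (r%:C * z) = r * part c z.
  by case: c z => -[a a'] /=; rewrite mul0r ?subr0 ?addr0 ?add0r.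
have partD c (I : Type) (t : seq I) (f : I -> R[i]) :
    part c (\sum_(i <- t) f i) = \sum_(i <- t) part c (f i).
  by apply: big_morph => [z1 z2|]; case: c => //=; case: z1; case: z2.
have normE z : Normc.normc z ^+ 2 = \sum_c part c z ^+ 2.
  by rewrite normc_sqrE big_bool.
have := hypercontractive N b q1 sv.
congr (_ <= _).
  apply: eq_bigr => r _; rewrite powRrM powR_mulrn ?normc_ge0// normE.
  congr (_ `^ _); apply: eq_bigr => c _; congr (_ ^+ 2).
  rewrite /signed_sum /poly_sum partD; apply: eq_bigr => s _.
  rewrite /b -!mulrA !partE; have [wt|wt] := eqVneq (weight s) l.
    by rewrite wt; have := expf_neq0 l s0; move: (sigma ^+ l) => K K0; field.
  by rewrite (dl wt) mul0r; case: (c) => /=; rewrite !mulr0.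
congr (_ * _ `^ _); rewrite exchange_big/= mulr_sumr; apply: eq_bigr => s _.
rewrite -normE !Normc.normcM normc_expi mulr1 exprMn; congr (_ * _).
rewrite /= expr0n addr0 sqr_sqrtr ?sqr_ge0// exprVn -exprM mulnC exprM s2.
by rewrite exprVn invrK.
Qed.

(** [riesz_domination] holds for each of the 2^N sign words, so it may be summed over them; at each
    grid point the sum over signs is then bounded by [signed_sum_moment]. *)
Lemma grid_moment_le (q x : R) : 1 <= q ->
  \sum_(i < M) Normc.normc (poly_sum n N d (x + i%:R / M%:R)) `^ (2 * q) <=
  M%:R * ((8 * (2 * q - 1)) ^+ l *
            \sum_(s <- words digits N) Normc.normc (d s) ^+ 2) `^ q.
Proof.
move=> q1; set E := \sum_(s <- words _ _) _.
have E0 : 0 <= E by apply: sumr_ge0 => s _; exact: sqr_ge0.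
have q2 : 1 <= 2 * q by lra.
have [cN N0] : size (words (signs R) N) = (2 ^ N)%N /\ 0 < 2 ^+ N :> R.
  split; last by rewrite exprn_gt0.
  by rewrite size_words.
rewrite -(ler_pM2l N0).
set G := \sum_(i < M) _.
have -> : 2 ^+ N * G = \sum_(r <- words (signs R) N) G.
  by rewrite big_const_seq count_predT cN iter_addr_0 -[G *+ _]mulr_natl natrX.
apply: le_trans (_ : \sum_(r <- words (signs R) N) (2 ^+ l) `^ (2 * q) *
  \sum_(i < M) Normc.normc (signed_sum r (x + i%:R / M%:R)) `^ (2 * q) <= _).
  rewrite big_seq [leRHS]big_seq; apply: ler_sum => r rW.
  exact: riesz_domination.
rewrite -mulr_sumr exchange_big/=.
apply: le_trans (ler_wpM2l _ (ler_sum _ (fun i _ => signed_sum_moment _ q1))) _.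
  exact: powR_ge0.
have v0 : 0 <= 2 * (2 * q - 1) by lra.
(* The domination constant (2^l)^(2q) equals (4^l)^q, and 4 times 2 gives 8. *)
have -> : ((8 * (2 * q - 1)) ^+ l * E) `^ q =
    (2 ^+ l) `^ (2 * q) * ((2 * (2 * q - 1)) ^+ l * E) `^ q.
  rewrite powRrM powR_mulrn ?exprn_ge0// -powRM ?exprn_ge0//; last first.
    by rewrite mulr_ge0// exprn_ge0.
  rewrite mulrA -exprM mulnC exprM -exprMn.
  by have -> : 2 ^+ 2 * (2 * (2 * q - 1)) = 8 * (2 * q - 1) by ring.
rewrite sumr_const card_ord -/E -[_ *+ M]mulr_natl.
by rewrite le_eqVlt; apply/orP; left; apply/eqP; ring.
Qed.

(** In the expanded square the off-diagonal terms vanish on the grid, and on the diagonal the phases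
    due to x cancel; so the identity is exact for every translate. *)
Lemma grid_Parseval (x : R) :
  \sum_(i < M) Normc.normc (poly_sum n N d (x + i%:R / M%:R)) ^+ 2 =
  M%:R * \sum_(s <- words digits N) Normc.normc (d s) ^+ 2.
Proof.
have normJ (z : R[i]) : (Normc.normc z ^+ 2)%:C = z * conjc z.
  rewrite normc_sqrE; case: z => a b; apply/eqP; rewrite eq_complex /=.
  by apply/andP; split; apply/eqP; ring.
have waveJ m y : conjc (wave m y : R[i]) = wave (- m) y.
  by rewrite /wave rmorphN/= mulrN mulNr /expi cosN sinN.
pose F t s := d s * conjc (d t) * (wave (lam n s) x * wave (- lam n t) x).
have conjM (z w : R[i]) : conjc (z * w) = conjc z * conjc w by exact: (rmorphM (@conjc R)).
have conjS (f : seq int -> R[i]) : conjc (\sum_(s <- words digits N) f s) =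
    \sum_(s <- words digits N) conjc (f s) by exact: (rmorph_sum (@conjc R)).
have normS (i : 'I_M) : (Normc.normc (poly_sum n N d (x + i%:R / M%:R)) ^+ 2)%:C =
    \sum_(t <- words digits N) \sum_(s <- words digits N)
      F t s * wave (lam n s - lam n t) (i%:R / M%:R).
  rewrite normJ {2}/poly_sum. rewrite conjS mulr_sumr.
  apply: eq_bigr => t _; rewrite /poly_sum mulr_suml; apply: eq_bigr => s _.
  by rewrite conjM waveJ waveDl !waveDr /F; ring.
apply: (@complexI R); rewrite (rmorphM (real_complex R)) rmorph_nat.
rewrite !(rmorph_sum (real_complex R))/=.
under eq_bigr do rewrite normS.
rewrite exchange_big/= mulr_sumr; apply: eq_big_seq => t tW.
have -> : (Normc.normc (d t) ^+ 2)%:C = F t t.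
  by rewrite normJ /F -waveDl subrr wave0 mulr1.
rewrite mulrC -(sum_words_orth (F t) n0 nlac MB tW) exchange_big/=.
by apply: eq_bigr => s _; rewrite mulr_sumr.
Qed.

End pointwise.

(** * Lebesgue integrals of periodic functions and the norms *)

Section periodic_integral.
Variable R : realType.
Notation mu := (@lebesgue_measure R).
Local Open Scope ereal_scope.

Lemma measurable_shift (a : R) :
  measurable_fun [set: measurableTypeR R] ((fun x => x + a)%R : R -> measurableTypeR R).
Proof. by apply: measurable_funD => //; exact: measurable_id. Qed.

(** The pushforward gives half-open intervals their length, which characterizes Lebesgue measure. *)
Lemma lebesgue_measure_shift (a : R) (A : set (measurableTypeR R)) :
  measurable A -> mu A = pushforward mu ((fun x => x + a)%R : R -> measurableTypeR R) A.
Proof.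
apply: (lebesgue_measure_unique
  (mu := measure_function_pushforward__canonical__measure_function_Measure
           mu (measurable_shift a))) => _ [[u v] _ <-] /=.
rewrite /pushforward.
have -> : (fun x => x + a)%R @^-1` `]u, v] = `](u - a)%R, (v - a)%R]%classic.
  by apply/seteqP; split => x /=; rewrite !in_itv/= ltrBlDr lerBrDr.
rewrite !lebesgue_measure_itv/= !lte_fin ltrD2r; case: ifP => // _.
by rewrite -!EFinB opprB addrA subrK.
Qed.

Lemma ge0_integral_shift (a : R) (D : set (measurableTypeR R))
    (f : measurableTypeR R -> \bar R) :
  measurable D -> measurable_fun D f -> {in D, forall x, 0 <= f x} ->
  \int[mu]_(x in D) f x = \int[mu]_(x in (fun x => x + a)%R @^-1` D) f (x + a)%R.
Proof.
move=> mD mf f0.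
rewrite -(ge0_integral_pushforward (measurable_shift a) mu mD mf f0).
apply: eq_measure_integral => [|? A mA _]; first exact: measurable_shift.
exact: lebesgue_measure_shift.
Qed.

Lemma ge0_integral_itv_split (a b c : R) (f : R -> \bar R) :
  (a <= b <= c)%R -> measurable_fun [set: R] f -> (forall x, 0 <= f x) ->
  \int[mu]_(x in `]a, c[) f x =
  \int[mu]_(x in `]a, b[) f x + \int[mu]_(x in `]b, c[) f x.
Proof.
move=> /andP[ab]; rewrite le_eqVlt => /predU1P[<-|bc] mf f0.
  by rewrite set_itvoo0 ?integral_set0 ?adde0.
have mfD D : measurable_fun D f by exact: measurable_funTS.
rewrite (@itv_bndbnd_setU _ _ _ (BRight b)) ?bnd_simp ?(ltW bc)//.
rewrite ge0_integral_setU//=; last 2 first.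
- exact: mfD.
- apply/disj_setPS => x /=; rewrite !in_itv/= => -[/andP[_ xb] /andP[bx _]].
  by move: (le_lt_trans xb bx); rewrite ltxx.
by congr (_ + _); rewrite -integral_itv_bndo_bndc.
Qed.

(** The translated interval is cut at 1; the piece beyond 1 moves back by one period onto the
    interval from 0 to a. *)
Lemma integral_periodic_shift (a : R) (f : R -> \bar R) : (0 <= a <= 1)%R ->
  measurable_fun [set: R] f -> (forall x, 0 <= f x) ->
  (forall x, f (x + 1)%R = f x) ->
  \int[mu]_(x in `]0%R, 1%R[) f (x + a)%R = \int[mu]_(x in `]0%R, 1%R[) f x.
Proof.
move=> /andP[a0 a1] mf f0 f1.
have mfD D : measurable_fun D f by exact: measurable_funTS.
have transl u v b : \int[mu]_(x in `](u + b)%R, (v + b)%R[) f x =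
    \int[mu]_(x in `]u, v[) f (x + b)%R.
  rewrite (@ge0_integral_shift b)//; last exact: mfD.
  have -> // : (fun x => x + b)%R @^-1` `](u + b)%R, (v + b)%R[ = `]u, v[%classic.
  by apply/seteqP; split => x /=; rewrite !in_itv/= !ltrD2r.
rewrite -[in LHS]transl add0r (@ge0_integral_itv_split a 1%R)//; last first.
  by rewrite a1/= lerDl.
rewrite [RHS](@ge0_integral_itv_split 0%R a)// ?a0// addeC; congr (_ + _).
have := transl 0%R a 1%R; rewrite add0r [(a + 1)%R]addrC => ->.
by apply: eq_integral => x _.
Qed.

(** All M translates have the same integral over a period. This is the passage from grid estimates,
    valid for every translate, to the norms. *)
Lemma integral_grid (M : nat) (F : R -> R) : (0 < M)%N ->
  measurable_fun [set: R] F -> (forall x, 0 <= F x)%R ->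
  (forall x, F (x + 1) = F x)%R ->
  (M%:R)%:E * \int[mu]_(x in `]0%R, 1%R[) (F x)%:E =
  \int[mu]_(x in `]0%R, 1%R[) (\sum_(i < M) F (x + i%:R / M%:R))%R%:E.
Proof.
move=> M0 mF F0 F1.
have mFs a : measurable_fun [set: R] (fun x => F (x + a))%R.
  exact: (measurableT_comp mF (measurable_shift a)).
under [RHS]eq_integral do rewrite -sumEFin.
rewrite ge0_integral_sum//; first last.
- by move=> i x _; rewrite lee_fin.
- by move=> i; apply/measurable_EFinP; exact: measurable_funTS (mFs _).
under eq_bigr => i _.
  rewrite (@integral_periodic_shift (i%:R / M%:R) (EFin \o F))//.
  - over.
  - by rewrite divr_ge0//= ler_pdivrMr ?ltr0n// mul1r ler_nat ltnW.
  - exact/measurable_EFinP.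
  - by move=> x /=; rewrite F1.
by rewrite mule_natl big_const_ord /enatmul Monoid.iteropE.
Qed.

Lemma integral_mrestr (D : set R) (mD : measurable D) (f : R -> \bar R) :
  measurable_fun [set: R] f -> (forall x, 0 <= f x) ->
  \int[mrestr mu mD]_x f x = \int[mu]_(x in D) f x.
Proof.
move=> mf f0; rewrite -(setUv D) ge0_integral_setU//; first last.
- by apply/disj_setPS => x [].
- by rewrite setUv.
- exact: measurableC.
rewrite [X in _ + X]null_set_integral ?adde0//.
- by apply: eq_measure_integral => A _ AD /=; rewrite /mrestr setIidl.
- exact: measurableC.
- exact: measurable_funTS.
- by rewrite /= /mrestr setICl measure0.
Qed.

Lemma cLnorm01E (p : R) (f : R -> R[i]) :
  measurable_fun [set: R] (@Normc.normc R \o f) ->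
  cLnorm01 p f =
  (\int[mu]_(x in `]0%R, 1%R[) (Normc.normc (f x) `^ p)%:E) `^ p^-1.
Proof.
move=> mf; rewrite /cLnorm01 unlock; congr (_ `^ _).
under eq_integral => x _ do
  rewrite /= ger0_norm ?normc_ge0//.
rewrite integral_mrestr// => [|x]; last by rewrite lee_fin powR_ge0.
apply/measurable_EFinP.
exact: (measurableT_comp (measurable_powR _)).
Qed.

End periodic_integral.

Lemma measurable_normc_poly_sum (R : realType) (n : nat -> nat) (N : nat)
    (d : seq int -> R[i]) :
  measurable_fun [set: R] (@Normc.normc R \o poly_sum n N d).
Proof.
pose part (c : bool) (z : R[i]) := if c then complex.Re z else complex.Im z.
have partD c (I : Type) (t : seq I) (f : I -> R[i]) :
    part c (\sum_(i <- t) f i) = \sum_(i <- t) part c (f i).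
  by apply: big_morph => [z1 z2|]; case: c => //=; case: z1; case: z2.
have mc (k : R) : measurable_fun [set: R] (fun x => cos (k * x)).
  apply: (measurableT_comp (continuous_measurable_fun (@continuous_cos R))).
  exact: measurable_funM.
have ms (k : R) : measurable_fun [set: R] (fun x => sin (k * x)).
  apply: (measurableT_comp (continuous_measurable_fun (@continuous_sin R))).
  exact: measurable_funM.
have mpart c : measurable_fun [set: R] (part c \o poly_sum n N d).
  have -> : part c \o poly_sum n N d = fun x =>
      \sum_(s <- words digits N) part c (d s * wave (lam n s) x).
    by apply/funext => x /=; rewrite partD.
  apply: measurable_sum => s; case: (d s) => a b; case: c => /=.
    by apply: measurable_funB; apply: measurable_funM.
  by apply: measurable_funD; apply: measurable_funM.
have -> : @Normc.normc R \o poly_sum n N d =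
    @Num.sqrt R \o (fun x => part true (poly_sum n N d x) ^+ 2
                           + part false (poly_sum n N d x) ^+ 2).
  by apply/funext => x /=; case: (poly_sum _ _ _ _).
apply: (measurableT_comp (continuous_measurable_fun (@sqrt_continuous R))).
by apply: measurable_funD; apply: measurable_funX;
  [exact: (mpart true)|exact: (mpart false)].
Qed.

(** * From signed sums to words *)

Lemma word_of_signed_sum (n : nat -> nat) (N l : nat) (k : 'I_l -> nat)
    (eps : 'I_l -> int) :
  (forall i j : 'I_l, (i < j)%N -> (k j < k i)%N) ->
  (forall j, eps j = 1 \/ eps j = -1) -> (forall j, (k j < N)%N) ->
  exists2 s, s \in words digits N &
    weight s = l /\ lam n s = \sum_(j < l) eps j * (n (k j))%:Z.
Proof.
elim: N l k eps => [|N IH] [|l] k eps kdec eps1 kN.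
- by exists [::] => //; rewrite big_ord0.
- by have := kN ord0.
- have [|s sW [ws ls]] := IH 0%N k eps kdec eps1; first by case.
  exists (0 :: s); first by move: sW; rewrite !mem_words/= eqSS.
  by rewrite /= mul0r add0r.
have cons_word e s : s \in words digits N -> e \in digits ->
    e :: s \in words digits N.+1.
  by rewrite !mem_words/= eqSS => /andP[-> ->] ->.
have eps_digit j : eps j \in digits by rewrite !inE; case: (eps1 j) => ->.
(* The first index is the largest: either it is N and supplies the head digit, or all indices are
   below N and the head digit is 0. *)
have [kN0|kN0] := eqVneq (k ord0) N.
  have [i j ij|j|j|s sW [ws ls]] :=
      IH l (fun j => k (lift ord0 j)) (fun j => eps (lift ord0 j)).
  - exact: kdec.
  - exact: eps1.
  - by rewrite -kN0 kdec.
  have sN : size s = N by move: sW; rewrite mem_words => /andP[/eqP].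
  exists (eps ord0 :: s); first exact: cons_word.
  rewrite /= ws ls big_ord_recl sN kN0; split => //.
  by case: (eps1 ord0) => ->.
have [j|s sW [ws ls]] := IH _ k eps kdec eps1.
  have k0 : (k ord0 < N)%N by rewrite ltn_neqAle kN0 -ltnS kN.
  case: (unliftP ord0 j) => [j' ->|-> //].
  by apply: ltn_trans k0; exact: kdec.
by exists (0 :: s); [exact: cons_word|rewrite /= ws ls mul0r add0r].
Qed.

Lemma signed_sum_words (n : nat -> nat) (l : nat) (X : set int) :
  finite_set X -> X `<=` signed_sums n l ->
  exists N, forall m, X m -> exists2 s, s \in words digits N &
    weight s = l /\ lam n s = m.
Proof.
move=> Xfin XA.
(* Asking for every larger length as well lets the maximum over the finite set serve all its
   elements. *)
have /choice[f fP] : forall m, exists N, X m -> forall N', (N <= N')%N ->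
    exists2 s, s \in words digits N' & weight s = l /\ lam n s = m.
  move=> m; have [Xm|] := pselect (X m); last by exists 0%N.
  have [k [eps [kdec eps1 ->]]] := XA _ Xm.
  exists (\max_(j < l) (k j).+1)%N => _ N' N'k.
  apply: word_of_signed_sum => // j; apply: leq_trans N'k.
  exact: (leq_bigmax j).
have /finite_seqP[t Xt] := Xfin.
exists (\max_(m <- t) f m)%N => m Xm; apply: fP => //.
by apply: leq_bigmax_seq => //; move: Xm; rewrite Xt.
Qed.

Lemma trig_sum_words (R : realType) (n : nat -> nat) (l : nat)
    (c : int -> R[i]) :
  (forall k, (0 < n k)%N) -> lacunary3 n ->
  finite_set (signed_sums n l `&` [set m | c m != 0]) ->
  exists N d, (forall s, weight s != l -> d s = 0) /\
    trig_sum (signed_sums n l) c = poly_sum n N d.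
Proof.
move=> n0 nlac cfin.
have [N NP] := signed_sum_words cfin (@subIsetl _ _ _).
(* [P] tests membership classically, so the frequencies listed in [T] lie in the index set by
   construction; they are distinct by [lam_inj]. *)
pose P s := (weight s == l) && `[< signed_sums n l (lam n s) >].
exists N, (fun s => if P s then c (lam n s) else 0).
split; first by move=> s /negbTE; rewrite /P => ->.
apply/funext => x; rewrite /poly_sum /trig_sum.
pose T := [seq lam n s | s <- words digits N & P s].
have uT : uniq T.
  rewrite map_inj_in_uniq ?filter_uniq ?words_uniq//.
  move=> s t; rewrite !mem_filter => /andP[_ sW] /andP[_ tW].
  exact: (lam_inj n0 nlac sW tW).
transitivity (\sum_(m <- T) c m * wave m x); last first.
  rewrite big_map big_filter big_mkcond; apply: eq_bigr => s _.
  by case: ifP; rewrite ?mul0r.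
rewrite [RHS]fsbig_seq//; symmetry.
apply: (@fsbig_widen _ _ _ _ [set` T] (signed_sums n l)
  (fun m => c m * wave m x)) => [m /=|m [Am /= mT]].
  by case/mapP => s; rewrite mem_filter => /andP[/andP[_ /asboolP ?] _] ->.
have [->|cm] := eqVneq (c m) 0; first by rewrite /= mul0r.
have [s sW [ws ls]] := NP m (conj Am cm); case: mT.
by apply/mapP; exists s; rewrite // mem_filter sW /P ws eqxx ls andbT; apply/asboolP.
Qed.

Local Close Scope complex_scope.

(** * The inequality between the norms *)

Theorem theorem1p2 (R : realType) (l : nat) (n : nat -> nat) (p : R)
    (c : int -> R[i])
    (hl : (2 <= l)%N)
    (hpos : forall k, (0 < n k)%N)
    (hlac : lacunary3 n)
    (hp : 2 < p)
    (hc : finite_set (signed_sums n l `&` [set m | c m != 0])) :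
  (cLnorm01 p (trig_sum (signed_sums n l) c)
   <= ((8 * (p - 1)) `^ (l%:R / 2))%:E
      * cLnorm01 2 (trig_sum (signed_sums n l) c))%E.
Proof.
have [N [d [dl ->]]] := trig_sum_words hpos hlac hc.
set S := poly_sum n N d.
set E := \sum_(s <- words digits N) Normc.normc (d s) ^+ 2.
have E0 : 0 <= E by apply: sumr_ge0 => s _; exact: sqr_ge0.
pose M := (2 * \sum_(k < N) n k).+1.
have MB : (2 * \sum_(k < N) n k < M)%N by exact: ltnSn.
have M0 : (0 < M)%N by [].
have MR : (0 < M%:R%:E :> \bar R)%E by rewrite lte_fin ltr0n.
have mS := measurable_normc_poly_sum n N d.
have mSp (r : R) : measurable_fun [set: R] (fun x => Normc.normc (S x) `^ r).
  exact: (measurableT_comp (measurable_powR r) mS).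
have Sp r x : 0 <= Normc.normc (S x) `^ r by exact: powR_ge0.
have S1 r x : Normc.normc (S (x + 1)) `^ r = Normc.normc (S x) `^ r.
  by rewrite /S poly_sum_periodic.
have cst01 (a : R) : (\int[lebesgue_measure]_(x in `]0%R, 1%R[) a%:E = a%:E)%E.
  rewrite integral_cst//= lebesgue_measure_itv/= lte_fin ltr01.
  by rewrite sube0 mule1.
(* By [grid_Parseval] the grid sum is the constant M E, so its integral gives the squared norm E
   after cancelling M. *)
have L2 : cLnorm01 2 S = (E `^ 2^-1)%:E.
  rewrite cLnorm01E// -poweR_EFin; congr (_ `^ _)%E.
  have := integral_grid M0 (mSp 2) (Sp 2) (S1 2).
  under [X in _ = X -> _]eq_integral do
    (under eq_bigr do rewrite powR_mulrn ?normc_ge0//;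
     rewrite (grid_Parseval _ hpos hlac MB)).
  rewrite cst01 EFinM => eqM.
  by apply/eqP; rewrite eq_le; apply/andP; split;
    rewrite -(lee_pmul2l _ MR)// eqM.
have K0 : 0 <= (8 * (p - 1)) ^+ l * E.
  by rewrite mulr_ge0// exprn_ge0//; lra.
have Lp : (cLnorm01 p S <= (((8 * (p - 1)) ^+ l * E) `^ 2^-1)%:E)%E.
  have p2 : 1 <= p / 2 by lra.
  have pE : 2 * (p / 2) = p by field.
  rewrite cLnorm01E//.
  (* The square root is rewritten as a p-th root, so that [grid_moment_le] with q = p / 2 can be
     compared under the integral. *)
  have -> : ((8 * (p - 1)) ^+ l * E) `^ 2^-1 =
      (((8 * (p - 1)) ^+ l * E) `^ (p / 2)) `^ p^-1.
    by rewrite -powRrM; congr (_ `^ _); field; rewrite gt_eqF//; lra.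
  rewrite -poweR_EFin; apply: gt0_ler_poweR.
  - by rewrite invr_ge0; lra.
  - by rewrite in_itv/= leey andbT integral_ge0// => x _; rewrite lee_fin.
  - by rewrite in_itv/= leey andbT lee_fin powR_ge0.
  rewrite -(lee_pmul2l _ MR)// (integral_grid M0 (mSp p) (Sp p) (S1 p)).
  rewrite -EFinM -[leRHS]cst01; apply: ge0_le_integral => //.
  - by move=> x _; rewrite lee_fin sumr_ge0.
  - apply/measurable_EFinP/measurable_funTS; apply: measurable_sum => i.
    exact: (measurableT_comp (mSp p) (measurable_shift _)).
  - move=> x _; rewrite lee_fin.
    by have := grid_moment_le hpos hlac MB dl x p2; rewrite !pE.
apply: le_trans Lp _; rewrite L2 -EFinM lee_fin powRM ?exprn_ge0//; last by lra.
rewrite -powR_mulrn; last by lra.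
by rewrite -powRrM.
Qed.
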